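(* Let $n\ge1$ and let $\alpha,\beta\in\mathbf{B}$ correspond to generalized Riemann differences $\Delta_{\mathcal{A}}$ and $\Delta_{\mathcal{B}}$, both of order $n$. Then: (i) $(\alpha)\supseteq(\beta)$ if and only if, for every function $f:\mathbb{R}\to\mathbb{R}$ and every real $x$, $f$ being $\mathcal{A}$-differentiable at $x$ implies that $f$ is $\mathcal{B}$-differentiable at $x$. (ii) $(\alpha)=(\beta)$ if and only if, for every function $f:\mathbb{R}\to\mathbb{R}$ and every real $x$, $f$ is $\mathcal{A}$-differentiable at $x$ if and only if $f$ is $\mathcal{B}$-differentiable at $x$.
   Context: A difference is an expression $\Delta_{\mathcal{A}}f(x,h)=\sum_{i}A_i f(x+a_ih)$ determined by a finite set of real parameters $\mathcal{A}=\{A_1,\ldots,A_p;a_1,\ldots,a_p\}$ with $a_1,\ldots,a_p$ distinct. For an integer $n\ge 1$, it is a generalized Riemann difference of order $n$ if the Vandermonde conditions $\sum_i A_i a_i^j=n!\,\delta_{jn}$ hold for $j=0,1,\ldots,n$. The $\mathcal{A}$-derivative is $D_{\mathcal{A}}f(x)=\lim_{h\to0}\Delta_{\mathcal{A}}f(x,h)/h^n$; $f$ is $\mathcal{A}$-differentiable at $x$ if this limit exists as a finite number. Let $k=\mathbb{R}$. $\mathbf{B}$ is the semigroup algebra over $k$ of the multiplicative monoid of all real numbers: it has $k$-basis $\{x_r : r\in\mathbb{R}\}$ with multiplication $x_rx_s=x_{rs}$ (so $x_1$ is the identity and $x_0x_r=x_0$). The element of $\mathbf{B}$ corresponding to the difference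 $\Delta_{\mathcal{A}}f(x,h)=\sum_iA_if(x+a_ih)$ is $\alpha=\sum_iA_ix_{a_i}$, and similarly $\beta=\sum_iB_ix_{b_i}$ corresponds to $\Delta_{\mathcal{B}}f(x,h)=\sum_iB_if(x+b_ih)$. For $\alpha\in\mathbf{B}$, $(\alpha)$ denotes the ideal of $\mathbf{B}$ generated by $\alpha$. *)

(* Defs.v *)
From HB Require Import structures.
From mathcomp Require Import all_boot all_order all_algebra finmap.
From mathcomp Require Import all_classical all_reals all_analysis.
(* The notations of monalg are incompatible with those of MathComp-Analysis. *)
From mathcomp.multinomials Require Import -(notations) monalg.

Set Implicit Arguments.
Unset Strict Implicit.
Unset Printing Implicit Defensive.

Import GRing.Theory Num.Theory.
Import numFieldNormedType.Exports.

Local Open Scope classical_set_scope.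
Local Open Scope ring_scope.

(* The semigroup algebra over k of the multiplicative monoid (k, * ) of k.
   [malg k k] is the k-module of finitely supported functions k -> k, with
   basis [mkmalgU r 1].  The product provided by monalg requires a [monomType]
   of exponents, i.e. a monoid in which x y = 1 forces x = y = 1; the monoid
   (k, * ) is not one, so the product is defined here, on an alias of
   [malg k k].                                                                *)
Definition mulAlg (k : comNzRingType) : Type := malg k k.

Section MulAlg.
Context (k : comNzRingType).
Local Notation B := (mulAlg k).

HB.instance Definition _ := GRing.Lmodule.copy B (malg k k).

Definition xgen (r : k) : B := mkmalgU r 1.

Definition mulAlg_one : B := xgen 1.

Definition mulAlg_mul (a b : B) : B :=
  \sum_(r <- msupp a) \sum_(s <- msupp b)
    (mcoeff r a * mcoeff s b) *: xgen (r * s).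

Implicit Types (a b c : B) (r s : k).

Lemma mulAlg_expand a : a = \sum_(r <- msupp a) mcoeff r a *: xgen r.
Proof.
rewrite [LHS](@monalgE k k a); apply: eq_bigr => r _.
by apply/malgP => s; rewrite mcoeffZ !mcoeffU mulrnAr mulr1.
Qed.

Let mulw (d1 d2 : {fset k}) a b :
  (msupp a `<=` d1)%fset -> (msupp b `<=` d2)%fset ->
  mulAlg_mul a b =
  \sum_(r <- d1) \sum_(s <- d2) (mcoeff r a * mcoeff s b) *: xgen (r * s).
Proof.
move=> le1 le2; rewrite /mulAlg_mul (big_fset_incl _ le1) /=.
  apply: eq_bigr => r _; apply: big_fset_incl => // s _ /mcoeff_outdom ->.
  by rewrite mulr0 scale0r.
move=> r _ /mcoeff_outdom ar; rewrite big1 // => s _.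
by rewrite ar mul0r scale0r.
Qed.

Lemma mulAlg_mulC : commutative mulAlg_mul.
Proof.
move=> a b; rewrite /mulAlg_mul exchange_big /=.
by apply: eq_bigr => r _; apply: eq_bigr => s _; rewrite mulrC [r * s]mulrC.
Qed.

Lemma mulAlg_mulDl : left_distributive mulAlg_mul +%R.
Proof.
move=> a b c.
have le := fsubset_refl (msupp c).
rewrite (mulw (msuppD_le a b) le).
rewrite (mulw (fsubsetUl (msupp a) (msupp b)) le).
rewrite (mulw (fsubsetUr (msupp a) (msupp b)) le).
rewrite -big_split; apply: eq_bigr => r _ /=.
rewrite -big_split; apply: eq_bigr => s _ /=.
by rewrite mcoeffD mulrDl scalerDl.
Qed.

Lemma mulAlg_mulZl (t : k) a b :
  mulAlg_mul (t *: a) b = t *: mulAlg_mul a b.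
Proof.
rewrite (mulw (msuppZ_le t a) (fsubset_refl (msupp b))) scaler_sumr.
apply: eq_bigr => r _; rewrite scaler_sumr; apply: eq_bigr => s _.
by rewrite mcoeffZ scalerA mulrA.
Qed.

Lemma mulAlg_mulUU r s : mulAlg_mul (xgen r) (xgen s) = xgen (r * s).
Proof.
rewrite (mulw (@msuppU_le _ _ r 1) (@msuppU_le _ _ s 1)) !big_seq_fset1.
by rewrite !mcoeffUU mulr1 scale1r.
Qed.

Let mul0 b : mulAlg_mul 0 b = 0.
Proof. by rewrite -(scale0r (0 : B)) mulAlg_mulZl !scale0r. Qed.

Let mul_suml (I : Type) (l : seq I) (F : I -> B) b :
  mulAlg_mul (\sum_(i <- l) F i) b = \sum_(i <- l) mulAlg_mul (F i) b.
Proof. exact: (big_morph (mulAlg_mul^~ b) (fun x y => mulAlg_mulDl x y b)). Qed.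

Let mul_sumr (I : Type) (l : seq I) (F : I -> B) b :
  mulAlg_mul b (\sum_(i <- l) F i) = \sum_(i <- l) mulAlg_mul b (F i).
Proof.
by rewrite mulAlg_mulC mul_suml; apply: eq_bigr => i _; rewrite mulAlg_mulC.
Qed.

Let mulZr (t : k) a b : mulAlg_mul a (t *: b) = t *: mulAlg_mul a b.
Proof. by rewrite mulAlg_mulC mulAlg_mulZl mulAlg_mulC. Qed.

Lemma mulAlg_mul1 : left_id mulAlg_one mulAlg_mul.
Proof.
move=> a; rewrite [in LHS](mulAlg_expand a) mul_sumr [RHS]mulAlg_expand.
by apply: eq_bigr => r _; rewrite mulZr mulAlg_mulUU mul1r.
Qed.

Lemma mulAlg_mulA : associative mulAlg_mul.
Proof.
move=> a b c; rewrite (mulAlg_expand a) (mul_suml _ _ b).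
rewrite (mul_suml _ _ (mulAlg_mul b c)) (mul_suml _ _ c).
apply: eq_bigr => r _; rewrite !mulAlg_mulZl; congr (_ *: _).
rewrite (mulAlg_expand b) (mul_suml _ _ c) (mul_sumr _ _ (xgen r)).
rewrite (mul_sumr _ _ (xgen r)) (mul_suml _ _ c).
apply: eq_bigr => s _; rewrite mulZr !mulAlg_mulZl mulZr; congr (_ *: _).
rewrite (mulAlg_expand c) (mul_sumr _ _ (xgen s)) (mul_sumr _ _ (xgen r)).
rewrite (mul_sumr _ _ (mulAlg_mul (xgen r) (xgen s))).
by apply: eq_bigr => t _; rewrite !mulZr !mulAlg_mulUU mulrA.
Qed.

Lemma mulAlg_one_neq0 : mulAlg_one != 0.
Proof. by apply/eqP/malgP => /(_ 1) /eqP; rewrite mcoeffUU mcoeff0 oner_eq0. Qed.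

HB.instance Definition _ := GRing.Zmodule_isComNzRing.Build B
  mulAlg_mulA mulAlg_mulC mulAlg_mul1 mulAlg_mulDl mulAlg_one_neq0.

HB.instance Definition _ := GRing.Lmodule_isLalgebra.Build k B
  (fun t a b => esym (mulAlg_mulZl t a b)).

HB.instance Definition _ := GRing.Lalgebra_isComAlgebra.Build k B.

Lemma xgenM r s : xgen r * xgen s = xgen (r * s).
Proof. exact: mulAlg_mulUU. Qed.

Lemma xgen1 : xgen 1 = 1.
Proof. by []. Qed.

End MulAlg.

(* MathComp's [idealr_closed] excludes the unit ideal. *)
Definition is_ideal (A : comNzRingType) (I : set A) : Prop :=
  [/\ I 0, (forall a b, I a -> I b -> I (a + b))
         & (forall c a, I a -> I (c * a))].

Definition ideal_gen (A : comNzRingType) (a : A) : set A :=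
  smallest (@is_ideal A) [set a].

Record difference (R : realType) := Difference {
  dsize : nat;
  dcoef : 'I_dsize -> R;
  dnode : 'I_dsize -> R;
  dnode_inj : injective dnode
}.

Section Difference.
Context (R : realType).
Implicit Types (D : difference R) (f : R -> R) (n : nat) (x h : R).

Definition diff_eval D f x h : R :=
  \sum_(i < dsize D) dcoef i * f (x + dnode i * h).

Definition diff_elt D : mulAlg R :=
  \sum_(i < dsize D) dcoef i *: xgen (dnode i).

(* The Vandermonde conditions, with the convention 0 ^+ 0 = 1. *)
Definition is_riemann_difference n D : Prop :=
  forall j, (j <= n)%N ->
    \sum_(i < dsize D) dcoef i * dnode i ^+ j = n`!%:R * (j == n)%:R.

(* [0^'] is the filter of punctured neighborhoods of 0; the limit is sought in
   R, hence is finite. *)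
Definition diff_differentiable n D f x : Prop :=
  cvg ((fun h => diff_eval D f x h / h ^+ n) @ (0 : R)^').

End Difference.

(* Main.v *)
Require Import Defs.
From mathcomp Require Import all_boot all_order all_algebra.
From mathcomp Require Import all_classical all_reals all_analysis.
From HB Require Import structures.
From mathcomp Require Import finmap.
From mathcomp.multinomials Require Import -(notations) monalg.

Set Implicit Arguments.
Unset Strict Implicit.
Unset Printing Implicit Defensive.

Import Order.TTheory GRing.Theory Num.Theory.
Import numFieldNormedType.Exports.

Local Open Scope classical_set_scope.
Local Open Scope ring_scope.

(** Fix f and x, and extend r |-> f (x + r) to a linear functional L on the
    semigroup algebra.  Then [diff_eval D f x h] is the value of L at
    [xgen h * diff_elt D], and every equivalence below comes from reading
    differences as such values.

    If beta = gamma * alpha, expanding gamma in the basis writes the B-difference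
    at h as a finite linear combination of A-differences at the dilates u h
    ([diff_eval_mul]).  For u <> 0 the quotient of the u-dilate by h^n
    still converges, with limit scaled by u^n; for u = 0 the difference vanishes,
    because the coefficients of a difference of positive order have sum 0.  So
    A-differentiability implies B-differentiability.

    Conversely let beta lie outside (alpha).  A linear functional kills (alpha)
    and is 1 at beta ([separating_functional]); its values on the basis form a
    function f all of whose A-differences at 0 vanish, while the B-difference of
    f at 0 with step h = 1 equals 1.  This only concerns one step, and has to be
    spread to steps tending to 0.  The nonzero nodes of both differences generate
    a countable multiplicative group, so some t in (0, 1) has no nontrivial
    power in this group, and r = g t^m |-> g is a well-defined retraction psi
    of a subgroup of R^* onto it.  Extended by 0, psi commutes with the dilations
    by all nodes and maps every t^m to 1 ([exists_collapse]).  Hence f \o psi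
    still has vanishing A-differences at 0, but its B-difference at 0 equals 1
    for all steps t^m.  Divided by (t^m)^n, it tends to infinity as m does, so
    f \o psi is A-differentiable and not B-differentiable at 0. *)

(** * Principal ideals *)

Lemma ideal_genP (A : comNzRingType) (a b : A) :
  ideal_gen a b <-> exists c, b = c * a.
Proof.
split=> [|[c ->] J [[_ _ mulJ] aJ]]; last by apply: mulJ; apply: aJ.
move=> /(_ [set x | exists c, x = c * a]); apply.
split=> [|x ->]; last by exists 1; rewrite mul1r.
split=> [|x y [c ->] [d ->]|d x [c ->]].
- by exists 0; rewrite mul0r.
- by exists (c + d); rewrite mulrDl.
- by exists (d * c); rewrite mulrA.
Qed.

Lemma ideal_gen_sub (A : comNzRingType) (a b : A) :
  ideal_gen b `<=` ideal_gen a <-> exists c, b = c * a.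
Proof.
split=> [sub|[c ->] x /ideal_genP[d ->]]; apply/ideal_genP.
  by apply: sub; apply/ideal_genP; exists 1; rewrite mul1r.
by exists (d * c); rewrite mulrA.
Qed.

(** * Linear functionals on the semigroup algebra *)

Section LinearExtension.
Context (k : comNzRingType) (f : k -> k).

(** The codomain is [k^o] because a linear form needs a module as its target. *)
Definition lin_ext (v : mulAlg k) : k^o :=
  \sum_(r <- msupp v) mcoeff r v * f r.

Let lin_extw (d : {fset k}) (v : mulAlg k) : (msupp v `<=` d)%fset ->
  lin_ext v = \sum_(r <- d) mcoeff r v * f r.
Proof.
by move=> le; apply: big_fset_incl => // r _ /mcoeff_outdom ->; rewrite mul0r.
Qed.

Let lin_ext_linear : linear lin_ext.
Proof.
move=> a v w; have le1 := fsubsetUl (msupp v) (msupp w).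
have le2 := fsubsetUr (msupp v) (msupp w).
rewrite (lin_extw le1) (lin_extw le2).
rewrite (@lin_extw (msupp v `|` msupp w)%fset).
  rewrite scaler_sumr -big_split; apply: eq_bigr => r _ /=.
  by rewrite mcoeffD mcoeffZ mulrDl -mulrA.
apply: fsubset_trans (msuppD_le _ _) _.
by apply: fsetSU; exact: msuppZ_le.
Qed.

HB.instance Definition _ := GRing.isLinear.Build k (mulAlg k) k^o _
  lin_ext lin_ext_linear.

Lemma lin_ext_xgen r : lin_ext (xgen r) = f r.
Proof.
by rewrite (lin_extw (@msuppU_le _ _ r 1)) big_seq_fset1 mcoeffUU mul1r.
Qed.

End LinearExtension.

Section Separation.
Context (k : fieldType) (V : lmodType k).
Implicit Types (I M : set V) (u v w b : V).

Definition lin_closed M := forall a v w, M v -> M w -> M (a *: v + w).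

(** For M maximal among the subspaces avoiding b, adding any v outside M to M
    captures b, and the resulting relation can be solved for v modulo M. *)
Lemma maximal_avoiding_subspace I b :
  I 0 -> lin_closed I -> ~ I b ->
  exists M, [/\ lin_closed M, I `<=` M, ~ M b
              & forall v, exists c, M (v - c *: b)].
Proof.
move=> I0 Icl Ib.
(* P does not ask that M contain I, only that it be stable under adding elements
   of I: the empty set then satisfies P, as the union of the empty chain must.
   A maximal M is nonempty, since I itself satisfies P. *)
pose P M := [/\ lin_closed M, (forall v w, M v -> I w -> M (v + w)) & ~ M b].
have [F sFP Ftot|M [[Mcl MI Mb] Mmax]] := @Zorn_bigcup V P.
  split=> [a v w [X FX Xv] [Y FY Yw]|v w [X FX Xv] Iw|[X FX]].
  - have [XY|YX] := Ftot _ _ FX FY.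
      by exists Y => //; have [Ycl _ _] := sFP _ FY; apply: Ycl => //; apply: XY.
    by exists X => //; have [Xcl _ _] := sFP _ FX; apply: Xcl => //; apply: YX.
  - by exists X => //; have [_ XI _] := sFP _ FX; apply: XI.
  - by have [_ _] := sFP _ FX.
have M0 : M 0.
  have [v Mv] : M !=set0.
    apply/set0P/negP => /eqP M0; apply: (Mmax I).
      by rewrite M0 properEneq; split; [apply/eqP => e; rewrite -e in I0|].
    by split=> // v w Iv Iw; rewrite -[v]scale1r; apply: Icl.
  by have := Mcl (-1) _ _ Mv Mv; rewrite scaleN1r addNr.
have sIM : I `<=` M by move=> v Iv; rewrite -[v]add0r; apply: MI.
have MZ a v : M v -> M (a *: v) by move=> Mv; rewrite -[_ *: _]addr0; apply: Mcl.
have MD v w : M v -> M w -> M (v + w).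
  by move=> Mv Mw; rewrite -[v]scale1r; apply: Mcl.
exists M; split=> // v.
have [Mv|Mv] := pselect (M v); first by exists 0; rewrite scale0r subr0.
pose N := [set w | exists c, M (w - c *: v)].
have sMN : M `<` N.
  split=> [w Mw|NM]; first by exists 0; rewrite scale0r subr0.
  by apply/Mv/NM; exists 1; rewrite scale1r subrr.
have Nb : N b.
  apply: contrapT => Nb; apply: (Mmax N sMN); split=> //.
    move=> a w1 w2 [c1 M1] [c2 M2]; exists (a * c1 + c2).
    by rewrite scalerDl -scalerA opprD addrACA -scalerBr; apply: Mcl.
  move=> w1 w2 [c M1] Iw; exists c.
  by rewrite addrAC; apply: MD => //; apply: sIM.
have [c Mc] := Nb; have c0 : c != 0.
  by apply/eqP => c0; apply: Mb; rewrite c0 scale0r subr0 in Mc.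
exists c^-1; have := MZ (- c^-1) _ Mc.
by rewrite scalerBr scalerA mulNr mulVf// !scaleNr scale1r opprK addrC.
Qed.

(** The functional is the coordinate along b in the decomposition of V as the
    direct sum of a maximal subspace avoiding b and of the line through b. *)
Lemma separating_functional I b :
  I 0 -> lin_closed I -> ~ I b ->
  exists L : {linear V -> k^o}, (forall v, I v -> L v = 0) /\ L b = 1.
Proof.
move=> I0 Icl /(maximal_avoiding_subspace I0 Icl)[M [Mcl sIM Mb Mspan]].
have M0 := sIM _ I0.
have MZ a v : M v -> M (a *: v) by move=> Mv; rewrite -[_ *: _]addr0; apply: Mcl.
have [l lP] := choice Mspan.
have l_uniq v c : M (v - c *: b) -> l v = c.
  move=> Mc; apply/eqP; rewrite -subr_eq0; apply/negP => /negP lc0; apply: Mb.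
  have := MZ (l v - c)^-1 _ (Mcl (-1) _ _ (lP v) Mc).
  rewrite scaleN1r opprB addrA subrK.
  by rewrite -scalerBl scalerA mulVf// scale1r.
have l_lin : linear (l : V -> k^o).
  move=> a v w; apply: l_uniq; rewrite scalerDl -scalerA opprD addrACA -scalerBr.
  exact: Mcl (lP v) (lP w).
pose L := GRing.isLinear.Build k V k^o _ l l_lin.
pose L' : {linear V -> k^o} := HB.pack l L.
exists L'; split=> [v Iv|]; apply: l_uniq.
  by rewrite scale0r subr0; apply: sIM.
by rewrite scale1r subrr.
Qed.

End Separation.

(** * Collapsing a geometric progression *)

Section Collapse.
Context (R : realType) (J : finType).
Implicit Types (c : J -> R) (e : {ffun J -> int}).

Definition monom c e : R := \prod_j c j ^ e j.

(** Each bad t in (0, 1) is an m-th root of one of the countably many monomials,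
    so the bad t form a countable set, hence a null set. *)
Lemma exists_independent_scale c : exists2 t : R, 0 < t < 1 &
  forall (m : int) e, t ^ m = monom c e -> m = 0.
Proof.
pose root (q : int * {ffun J -> int}) : R := monom c q.2 `^ (q.1%:~R)^-1.
have cnt : countable (range root).
  by apply: sub_countable (card_image_le _ _) (countableP _).
have /existsNP[t /not_implyP[]] : ~ (`]0%R, 1%R[ `<=` range root).
  move=> /subset_card_le/sub_countable/(_ cnt)/countable_lebesgue_measure0.
  rewrite lebesgue_measure_itv /= lte01 sube0 => /eqP.
  by rewrite onee_eq0.
rewrite /= in_itv /= => t01 nroot; exists t => // m e tm.
apply/eqP/negP => /negP m0; apply: nroot; exists (m, e) => //.
have t0 : 0 <= t by case/andP: t01 => /ltW.
rewrite /root /= -tm -powR_intmul// -powRrM mulfV ?intr_eq0//.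
by rewrite powRr1.
Qed.

(** With G the group generated by the nonzero c j and t multiplicatively
    independent of G, psi maps g t^m to g for g in G and m an integer, and
    everything outside the group generated by G and t to 0.  Multiplication by
    a nonzero c j preserves that group and its complement; as psi 0 = 0, the
    dilation rule also covers c j = 0. *)
Lemma exists_collapse c : exists t (psi : R -> R),
  [/\ 0 < t < 1, forall j r, psi (c j * r) = c j * psi r
    & forall m, psi (t ^+ m) = 1].
Proof.
(* Putting 1 for the zeros of c gives the same group G, generated by nonzero
   elements only. *)
pose d j := if c j == 0 then 1 else c j.
have d0 j : d j != 0 by rewrite /d; case: ifP => [_|/negbT//]; exact: oner_neq0.
have mon0 e : monom d e != 0.
  by apply/prodf_neq0 => j _; rewrite expfz_neq0.
have monD e1 e2 : monom d [ffun j => e1 j + e2 j] = monom d e1 * monom d e2.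
  by rewrite -big_split; apply: eq_bigr => j _; rewrite ffunE expfzDr.
have monN e : monom d [ffun j => - e j] = (monom d e)^-1.
  by rewrite -prodfV; apply: eq_bigr => j _; rewrite ffunE invr_expz.
have mon1 j : monom d [ffun i => (i == j)%:Z] = d j.
  rewrite /monom (bigD1 j) //= big1 => [|i /negPf ij]; rewrite ffunE ?eqxx ?mulr1//.
  by rewrite ij.
have [t t01 tP] := exists_independent_scale d.
have t0 : t != 0 by case/andP: t01 => /gt_eqF ->.
pose G (q : {ffun J -> int} * int) := monom d q.1 * t ^ q.2.
have G_inj q1 q2 : G q1 = G q2 -> monom d q1.1 = monom d q2.1.
  case: q1 q2 => [e1 m1] [e2 m2]; rewrite /G /= => E.
  have mm : m1 - m2 = 0.
    apply: (tP _ [ffun j => e2 j + [ffun i => - e1 i] j]).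
    rewrite monD monN expfzDr// -invr_expz.
    apply: (mulfI (mon0 e1)); rewrite mulrA E mulfK ?expfz_neq0//.
    by rewrite mulrCA mulfV ?mulr1.
  move/eqP: mm; rewrite subr_eq0 => /eqP mm; move: E; rewrite mm.
  by apply: mulIf; rewrite expfz_neq0.
pose psi r := if pselect (exists q, r = G q) is left h then monom d (projT1 (cid h)).1 else 0.
have psiG q : psi (G q) = monom d q.1.
  rewrite /psi; case: pselect => [h|[]]; last by exists q.
  by case: cid => q' /= /G_inj.
have psiN r : ~ (exists q, r = G q) -> psi r = 0.
  by rewrite /psi; case: pselect.
have psi0 : psi 0 = 0.
  apply: psiN => -[q /esym/eqP]; rewrite mulf_eq0 (negPf (mon0 _)) /=.
  by rewrite (negPf (expfz_neq0 _ _)).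
exists t, psi; split=> // [j r|m]; last first.
  have -> : t ^+ m = G ([ffun=> 0], m%:Z).
    by rewrite /G /monom big1 ?mul1r// => j _; rewrite ffunE.
  by rewrite psiG /monom big1// => j _; rewrite ffunE.
have [cj0|cj0] := eqVneq (c j) 0; first by rewrite cj0 !mul0r.
have dj : d j = c j by rewrite /d (negPf cj0).
have Gj q : c j * G q = G ([ffun i => [ffun l => (l == j)%:Z] i + q.1 i], q.2).
  by rewrite /G /= monD mon1 dj mulrA.
have [[q ->]|h] := pselect (exists q, r = G q).
  by rewrite Gj !psiG /= monD mon1 dj.
rewrite (psiN r)// mulr0; apply: psiN => -[q E]; apply: h.
(* If c j * r = G q, dividing q by c j shows that r is already of the form G q'. *)
exists ([ffun i => [ffun l => - [ffun u => (u == j)%:Z] l] i + q.1 i], q.2).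
apply: (mulfI cj0); rewrite E /G /= monD monN mon1 dj.
by rewrite !mulrA mulfV ?mul1r.
Qed.

End Collapse.

(** * Differences and multiples of their elements *)

Section Differences.
Context (R : realType).
Implicit Types (D DA DB : difference R) (f : R -> R) (c : mulAlg R).

(** The algebra element [xgen r * diff_elt D] is the dilate of D by r. *)
Lemma linear_dilate (L : {linear mulAlg R -> R^o}) D r :
  L (xgen r * diff_elt D) = \sum_(i < dsize D) dcoef i * L (xgen (dnode i * r)).
Proof.
rewrite mulr_sumr linear_sum; apply: eq_bigr => i _.
by rewrite -scalerAr xgenM linearZ mulrC.
Qed.

Lemma diff_eval_lin_ext D f x h :
  diff_eval D f x h = lin_ext (fun r => f (x + r)) (xgen h * diff_elt D).
Proof.
by rewrite linear_dilate; apply: eq_bigr => i _; rewrite /= lin_ext_xgen.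
Qed.

Lemma diff_eval_mul c DA DB f x h : diff_elt DB = c * diff_elt DA ->
  diff_eval DB f x h = \sum_(u <- msupp c) mcoeff u c * diff_eval DA f x (u * h).
Proof.
move=> BcA; rewrite diff_eval_lin_ext BcA mulrCA [in LHS](mulAlg_expand c).
rewrite mulr_suml linear_sum; apply: eq_bigr => u _.
by rewrite diff_eval_lin_ext -scalerAl linearZ mulrA xgenM.
Qed.

Lemma is_cvg_sum (T : Type) (F : set_system T) (I : Type) (s : seq I)
    (u : I -> T -> R) : Filter F ->
  (forall i, cvg (u i @ F)) -> cvg ((fun t => \sum_(i <- s) u i t) @ F).
Proof.
move=> FF cu; elim: s => [|i s IHs].
  by under eq_fun do rewrite big_nil; exact: is_cvg_cst.
by under eq_fun do rewrite big_cons; apply: is_cvgD.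
Qed.

Lemma cvg_dilate_dnbhs (u : R) : u != 0 -> u * h @[h --> 0^'] --> (0 : R)^'.
Proof.
move=> u0 A; rewrite /nbhs /= => -[e /= e0 sub]; exists (e / `|u|) => /=.
  by rewrite divr_gt0// normr_gt0.
move=> h /=; rewrite !sub0r !normrN => he h0; apply: sub => /=.
  by rewrite sub0r normrN normrM mulrC -ltr_pdivlMr// normr_gt0.
by rewrite mulf_neq0.
Qed.

(** All nodes collapse to x, so the value is f x times the sum of the
    coefficients, which the Vandermonde condition with exponent 0 kills. *)
Lemma diff_eval0 n D f x : (0 < n)%N -> is_riemann_difference n D ->
  diff_eval D f x 0 = 0.
Proof.
move=> n0 /(_ 0 (leq0n n)); rewrite eq_sym eqn0Ngt n0 mulr0 => sum0.
transitivity ((\sum_(i < dsize D) dcoef i) * f x).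
  by rewrite mulr_suml; apply: eq_bigr => i _; rewrite mulr0 addr0.
by under eq_bigr do rewrite -[dcoef _]mulr1; rewrite sum0 mul0r.
Qed.

Lemma differentiable_dilate n D f x (u : R) : (0 < n)%N ->
  is_riemann_difference n D -> diff_differentiable n D f x ->
  cvg ((fun h => diff_eval D f x (u * h) / h ^+ n) @ (0 : R)^').
Proof.
move=> n0 hD /cvg_ex[/= l Dl]; have [->|u0] := eqVneq u 0.
  under eq_fun do rewrite mul0r (diff_eval0 _ _ n0 hD) mul0r.
  exact: is_cvg_cst.
apply/cvg_ex; exists (u ^+ n * l).
apply: cvg_trans (cvgM (cvg_cst (u ^+ n)) (cvg_comp _ _ (cvg_dilate_dnbhs u0) Dl)).
apply: near_eq_cvg; apply: nearW => h /=.
by rewrite exprMn invfM mulrCA mulVKf ?expf_neq0.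
Qed.

Lemma differentiable_mul n c DA DB f x : (0 < n)%N ->
  is_riemann_difference n DA -> diff_elt DB = c * diff_elt DA ->
  diff_differentiable n DA f x -> diff_differentiable n DB f x.
Proof.
move=> n0 hA BcA dA; rewrite /diff_differentiable.
under eq_fun do rewrite (diff_eval_mul _ _ _ BcA) mulr_suml.
apply: is_cvg_sum => u; under eq_fun do rewrite -mulrA.
by apply: is_cvgM; [exact: is_cvg_cst|exact: differentiable_dilate].
Qed.

(** Along the steps t^m the quotient is a * t^(- m n), which is unbounded.  The
    proof multiplies a supposed limit by (t^n)^m, which tends to 0, and gets
    back the nonzero constant a. *)
Lemma not_cvg_const_geometric n (g : R -> R) (t a : R) :
  (0 < n)%N -> 0 < t < 1 -> a != 0 -> (forall m, g (t ^+ m) = a) ->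
  ~ cvg ((fun h => g h / h ^+ n) @ (0 : R)^').
Proof.
move=> n0 t01 a0 gt /cvg_ex[/= l /cvgr_dnbhsP gl].
have /andP[t0 t1] := t01.
have tm0 m : t ^+ m != 0 by rewrite expf_neq0// gt_eqF.
have tto : t ^+ m @[m --> \oo] --> 0 by apply: cvg_expr; rewrite gtr0_norm.
have := gl _ (conj tm0 tto).
have tnto : (t ^+ n) ^+ m @[m --> \oo] --> 0.
  by apply: cvg_expr; rewrite gtr0_norm ?exprn_gt0// exprn_ilt1 ?ltW// -lt0n.
move=> /(cvgM tnto); rewrite mul0r => lim0.
have lima : (fun=> a) @ \oo --> (0 : R).
  apply: cvg_trans lim0; apply: near_eq_cvg; apply: nearW => m /=.
  by rewrite gt -exprM mulnC exprM mulrCA mulfV ?mulr1// expf_neq0.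
by move/eqP: a0; apply; apply: (cvg_unique _ (cvg_cst a) lima).
Qed.

End Differences.

(** The counterexample F is f \o psi, where f is the separating functional L on
    the basis and psi collapses the powers of t to 1. *)
Lemma differentiable_imp_mul (R : realType) n (DA DB : difference R) :
  (0 < n)%N ->
  (forall f x, diff_differentiable n DA f x -> diff_differentiable n DB f x) ->
  exists c, diff_elt DB = c * diff_elt DA.
Proof.
move=> n0 AB; apply: contrapT => nB.
pose I : set (mulAlg R) := [set v | exists c, v = c * diff_elt DA].
have I0 : I 0 by exists 0; rewrite mul0r.
have Icl : lin_closed I.
  by move=> a _ _ [c ->] [d ->]; exists (a *: c + d); rewrite mulrDl scalerAl.
have [L [LI LB]] := separating_functional I0 Icl nB.
pose c (j : 'I_(dsize DA) + 'I_(dsize DB)) :=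
  match j with inl i => dnode i | inr i => dnode i end.
have [t [psi [t01 psic psit]]] := exists_collapse c.
pose F r : R := L (xgen (psi r)).
have evalF D h : (forall i r, psi (@dnode _ D i * r) = dnode i * psi r) ->
    diff_eval D F 0 h = L (xgen (psi h) * diff_elt D).
  move=> psiD; rewrite linear_dilate; apply: eq_bigr => i _.
  by rewrite /F add0r psiD.
have FA : diff_differentiable n DA F 0.
  have F0 h : diff_eval DA F 0 h = 0.
    by rewrite (evalF _ _ (fun i => psic (inl i))); apply: LI; exists (xgen (psi h)).
  rewrite /diff_differentiable; under eq_fun do rewrite F0 mul0r.
  exact: is_cvg_cst.
have FB m : diff_eval DB F 0 (t ^+ m) = 1.
  by rewrite (evalF _ _ (fun i => psic (inr i))) psit xgen1 mul1r.
exact: not_cvg_const_geometric n0 t01 (oner_neq0 _) FB (AB _ _ FA).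
Qed.

Theorem theorem5 (R : realType) (n : nat) (DA DB : difference R)
    (hn : (1 <= n)%N)
    (hA : is_riemann_difference n DA) (hB : is_riemann_difference n DB) :
  (ideal_gen (diff_elt DB) `<=` ideal_gen (diff_elt DA) <->
     forall (f : R -> R) (x : R),
       diff_differentiable n DA f x -> diff_differentiable n DB f x) /\
  (ideal_gen (diff_elt DA) = ideal_gen (diff_elt DB) <->
     forall (f : R -> R) (x : R),
       diff_differentiable n DA f x <-> diff_differentiable n DB f x).
Proof.
have sub_iff D D' : is_riemann_difference n D ->
    ideal_gen (diff_elt D') `<=` ideal_gen (diff_elt D) <->
    forall (f : R -> R) (x : R),
      diff_differentiable n D f x -> diff_differentiable n D' f x.
  move=> hD; rewrite ideal_gen_sub; split=> [[c E] f x|].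
    exact: differentiable_mul E.
  exact: differentiable_imp_mul.
split; first exact: sub_iff.
split=> [E f x|AB].
  split; first by apply: (sub_iff DA DB hA).1; rewrite E.
  by apply: (sub_iff DB DA hB).1; rewrite E.
apply/seteqP; split.
  by apply: (sub_iff DB DA hB).2 => f x; exact: (AB f x).2.
by apply: (sub_iff DA DB hA).2 => f x; exact: (AB f x).1.
Qed.
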